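(* Consider the random vectors $\mathbf{x},\mathbf{y}$ in $\mathbb{R}^N$ described in the context, with graph Fourier transforms $\tilde{\mathbf{x}}=\mathbf{V}^T\mathbf{x}$, $\tilde{\mathbf{y}}=\mathbf{V}^T\mathbf{y}$, and assume $\mathbf{D}_{\tilde{\mathbf{y}}\tilde{\mathbf{y}}}$ is non-singular. Let $\Omega_{\boldsymbol{\alpha}}$ be a parameter set and let $h(\boldsymbol{\Lambda};\boldsymbol{\alpha})$, $\boldsymbol{\alpha}\in\Omega_{\boldsymbol{\alpha}}$, be any graph-filter parametrization, so that for each $\boldsymbol{\alpha}$ the matrix $h(\boldsymbol{\Lambda};\boldsymbol{\alpha})$ is a real diagonal $N\times N$ matrix. Then the minimization problem $$\hat{\boldsymbol{\alpha}}=\operatorname*{argmin}_{\boldsymbol{\alpha}\in\Omega_{\boldsymbol{\alpha}}}\ \mathbb{E}\left[\left\|h(\boldsymbol{\Lambda};\boldsymbol{\alpha})(\tilde{\mathbf{y}}-\mathbb{E}[\tilde{\mathbf{y}}])-(\tilde{\mathbf{x}}-\mathbb{E}[\tilde{\mathbf{x}}])\right\|^2\right]$$ is equivalent to (i.e. has the same set of minimizers as) the weighted least-squares problem $$\hat{\boldsymbol{\alpha}}=\operatorname*{argmin}_{\boldsymbol{\alpha}\in\Omega_{\boldsymbol{\alpha}}}\ \left\|\mathbf{D}_{\tilde{\mathbf{y}}\tilde{\mathbf{y}}}^{1/2}\left(\mathrm{diag}(h(\boldsymbol{\Lambda};\boldsymbol{\alpha}))-\mathrm{diag}(\hat f(\boldsymbol{\Lambda}))\right)\right\|^2,$$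 where $\hat f(\boldsymbol{\Lambda})=\mathrm{diag}(\mathbf{d}_{\tilde{\mathbf{x}}\tilde{\mathbf{y}}})\,\mathbf{D}_{\tilde{\mathbf{y}}\tilde{\mathbf{y}}}^{-1}$.
   Context: Graph: $\mathcal{G}$ is an undirected connected weighted graph on $N$ vertices with symmetric non-negative weighted adjacency matrix $\mathbf{W}\in\mathbb{R}^{N\times N}$ and Laplacian $\mathbf{L}=\mathrm{diag}(\mathbf{W}\mathbf{1})-\mathbf{W}$. Its eigenvalue decomposition is $\mathbf{L}=\mathbf{V}\boldsymbol{\Lambda}\mathbf{V}^T$, where $\boldsymbol{\Lambda}$ is diagonal with $0=\lambda_1<\lambda_2\le\dots\le\lambda_N$ and $\mathbf{V}$ is orthogonal. A graph filter is a matrix of the form $\mathbf{V}\mathbf{F}\mathbf{V}^T$ with $\mathbf{F}$ diagonal; a graph-filter parametrization takes $\mathbf{F}=h(\boldsymbol{\Lambda};\boldsymbol{\alpha})$, a diagonal matrix depending on a parameter vector $\boldsymbol{\alpha}$, whose $n$th diagonal entry is the frequency response at graph frequency $\lambda_n$. Model: $\mathbf{y}=\mathbf{g}(\mathbf{L},\mathbf{x})+\mathbf{w}$, where $\mathbf{g}:\mathbb{R}^{N\times N}\times\mathbb{R}^N\to\mathbb{R}^N$ is a known (measurable) function, $\mathbf{x}$ is a random vector in $\mathbb{R}^N$, and $\mathbf{w}$ is a zero-mean random noise vector independent of $\mathbf{x}$; all random vectors have finite second moments. Notation: $\mathbf{C}_{\mathbf{a}\mathbf{b}}=\mathbb{E}[(\mathbf{a}-\mathbb{E}[\mathbf{a}])(\mathbf{b}-\mathbb{E}[\mathbf{b}])^T]$.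 For a vector $\mathbf{a}$, $\mathrm{diag}(\mathbf{a})$ is the diagonal matrix with diagonal $\mathbf{a}$; for a matrix $\mathbf{A}$, $\mathrm{diag}(\mathbf{A})$ is the vector of its diagonal entries. Put $\mathbf{d}_{\tilde{\mathbf{x}}\tilde{\mathbf{y}}}=\mathrm{diag}(\mathbf{C}_{\tilde{\mathbf{x}}\tilde{\mathbf{y}}})$ and $\mathbf{D}_{\tilde{\mathbf{y}}\tilde{\mathbf{y}}}=\mathrm{diag}(\mathrm{diag}(\mathbf{C}_{\tilde{\mathbf{y}}\tilde{\mathbf{y}}}))$. $\|\cdot\|$ is the Euclidean norm. *)

(* Defs.v *)
(* MathComp / MathComp-Analysis development. *)
From mathcomp Require Import all_boot all_order all_algebra.
From mathcomp Require Import all_classical all_reals all_analysis.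

Set Implicit Arguments.
Unset Strict Implicit.
Unset Printing Implicit Defensive.

Import Order.TTheory GRing.Theory Num.Theory.
Import numFieldNormedType.Exports.

Local Open Scope classical_set_scope.
Local Open Scope ring_scope.

Definition diagm (R : realType) (N : nat) (a : 'cV[R]_N) : 'M[R]_N :=
  diag_mx a^T.

Definition diagv (R : realType) (N : nat) (A : 'M[R]_N) : 'cV[R]_N :=
  \col_i A i i.

(* The library norm `|v| on matrices is the sup norm, hence this one. *)
Definition enorm (R : realType) (N : nat) (v : 'cV[R]_N) : R :=
  Num.sqrt (\sum_i v i ord0 ^+ 2).

(* For a diagonal matrix with non-negative entries this is the principal
   square root D^(1/2); it is only applied to such matrices. *)
Definition diag_sqrt (R : realType) (N : nat) (D : 'M[R]_N) : 'M[R]_N :=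
  map_mx Num.sqrt D.

(* Self-loops (W i i > 0) are not excluded; they do not affect the Laplacian. *)
Definition connected_weighted_graph (R : realType) (N : nat) (W : 'M[R]_N) :=
  [/\ (0 < N)%N,
      W^T = W,
      forall i j, 0 <= W i j &
      forall i j, connect [rel k l | 0 < W k l] i j].

Definition laplacian (R : realType) (N : nat) (W : 'M[R]_N) : 'M[R]_N :=
  diagm (W *m const_mx 1) - W.

(* Indices start at 0, so the eigenvalue lambda_1 = 0 is lam i ord0 with
   i = 0. *)
Definition laplacian_evd (R : realType) (N : nat) (L V : 'M[R]_N)
    (lam : 'cV[R]_N) :=
  [/\ V^T *m V = 1%:M,
      L = V *m diagm lam *m V^T,
      forall i : 'I_N, i = 0%N :> nat -> lam i ord0 = 0,
      forall i : 'I_N, (0 < i)%N -> 0 < lam i ord0 &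
      forall i j : 'I_N, (i <= j)%N -> lam i ord0 <= lam j ord0].

(* X with its Borel sigma-algebra. *)
Definition borel (X : ptopologicalType) := g_sigma_algebraType (@open X).

Definition independent_RVs d d1 d2 (T : measurableType d)
    (T1 : measurableType d1) (T2 : measurableType d2) (R : realType)
    (P : probability T R) (X : T -> T1) (Y : T -> T2) :=
  forall (A : set T1) (B : set T2), measurable A -> measurable B ->
    (P (X @^-1` A `&` Y @^-1` B) = P (X @^-1` A) * P (Y @^-1` B))%E.

Definition finite_second_moments d (T : measurableType d) (R : realType)
    (P : probability T R) (N : nat) (X : T -> 'cV[R]_N) :=
  forall i, (fun t => X t i ord0) \in Lfun P 2%:E.

(* Entrywise; fine sends an infinite or undefined expectation to a junk
   value, so this is meaningful for integrable entries only. *)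
Definition Emx d (T : measurableType d) (R : realType)
    (P : probability T R) (m n : nat) (X : T -> 'M[R]_(m, n)) : 'M[R]_(m, n) :=
  \matrix_(i, j) fine ('E_P[fun t => X t i j])%E.

Definition cov_mx d (T : measurableType d) (R : realType)
    (P : probability T R) (m n : nat) (a : T -> 'cV[R]_m) (b : T -> 'cV[R]_n) :
    'M[R]_(m, n) :=
  Emx P (fun t => (a t - Emx P a) *m (b t - Emx P b)^T).

Definition gft (R : realType) (T : Type) (N : nat) (V : 'M[R]_N)
    (X : T -> 'cV[R]_N) : T -> 'cV[R]_N :=
  fun t => V^T *m X t.

Definition argmin d (T : porderType d) (A : Type) (Omega : set A)
    (f : A -> T) : set A :=
  [set a | Omega a /\ forall b, Omega b -> (f a <= f b)%O].

(* Main.v *)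
(* Since the filter F is diagonal, the mean squared error splits into one
   scalar problem per graph frequency, namely
   F_ii^2 C_yy,ii - 2 F_ii C_xy,ii + C_xx,ii.  Completing the square gives
   C_yy,ii (F_ii - C_xy,ii / C_yy,ii)^2 plus a term independent of F, so the
   two objectives differ by a constant. *)
Require Import Defs.
From mathcomp Require Import all_boot all_order all_algebra.
From mathcomp Require Import all_classical all_reals all_analysis.
From mathcomp Require Import ring.

Set Implicit Arguments.
Unset Strict Implicit.
Unset Printing Implicit Defensive.

Import Order.TTheory GRing.Theory Num.Theory.
Import numFieldNormedType.Exports.

Local Open Scope classical_set_scope.
Local Open Scope ring_scope.

Lemma enorm_sqr (R : realType) (N : nat) (v : 'cV[R]_N) :
  enorm v ^+ 2 = \sum_i v i ord0 ^+ 2.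
Proof. by rewrite sqr_sqrtr// sumr_ge0// => i _; rewrite sqr_ge0. Qed.

Lemma is_diag_mx_mulE (R : pzRingType) (N : nat) (F : 'M[R]_N) (v : 'cV[R]_N) i :
  is_diag_mx F -> (F *m v) i ord0 = F i i * v i ord0.
Proof.
move=> /is_diag_mxP dF; rewrite mxE (bigD1 i)//= big1 ?addr0// => j ji.
by rewrite dF ?mul0r// eq_sym.
Qed.

Lemma diagm_is_diag (R : realType) (N : nat) (a : 'cV[R]_N) :
  is_diag_mx (diagm a).
Proof. by apply: diag_mx_is_diag. Qed.

(** The two diagonal matrices multiply to the identity, which also makes the first one a unit, so
    cancelling it identifies its inverse. *)
Lemma invmx_diagm (R : realType) (N : nat) (a : 'cV[R]_N) :
  (forall i, a i ord0 != 0) ->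
  invmx (diagm a) = diagm (map_mx (@GRing.inv R) a).
Proof.
move=> a0; have aV : diagm a *m diagm (map_mx (@GRing.inv R) a) = 1%:M.
  rewrite mulmx_diag -diag_const_mx; congr diag_mx; apply/rowP => i.
  by rewrite !mxE mulfV.
have [ua _] := mulmx1_unit aV.
by rewrite -[RHS](mulKmx ua) aV mulmx1.
Qed.

Lemma diagm_unit_neq0 (R : realType) (N : nat) (a : 'cV[R]_N) :
  diagm a \in unitmx -> forall i, a i ord0 != 0.
Proof.
rewrite unitmxE det_diag unitfE => /prodf_neq0 a0 i.
by have := a0 i isT; rewrite mxE.
Qed.

Lemma finite_second_moments_mulmx d (T : measurableType d) (R : realType)
    (P : probability T R) (m n : nat) (B : 'M[R]_(m, n)) (X : T -> 'cV[R]_n) :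
  finite_second_moments P X -> finite_second_moments P (fun t => B *m X t).
Proof.
move=> X2 i.
have -> : (fun t => (B *m X t) i ord0) =
    \sum_j (B i j \o* (fun t => X t j ord0)).
  apply/funext => t; rewrite mxE fct_sumE.
  by apply: eq_bigr => j _; rewrite /= mulrC.
apply: rpred_sum => [|le12 j _]; first by rewrite lee_fin ler1n.
by apply: Lfun_scale; [rewrite ler1n|exact: X2].
Qed.

(** Constants are square-integrable under a probability measure, and [Lfun P 2%:E] is closed under
    subtraction. *)
Lemma centered_second_moments d (T : measurableType d) (R : realType)
    (P : probability T R) (n : nat) (X : T -> 'cV[R]_n) (c : 'cV[R]_n) :
  finite_second_moments P X -> finite_second_moments P (fun t => X t - c).
Proof.
move=> X2 i.
have -> : (fun t => (X t - c) i ord0) = (fun t => X t i ord0) - cst (c i ord0).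
  by apply/funext => t; rewrite !mxE.
by apply: rpredB; [rewrite lee_fin ler1n|move=> ?; exact: X2|move=> ?; exact: Lfun_cst].
Qed.

(** A product of two square-integrable functions is integrable, so the square can be expanded and
    linearity of expectation applied. The integrability half is what allows these residuals to be
    summed under the expectation later. *)
Lemma expectation_residual_sqr d (T : measurableType d) (R : realType)
    (P : probability T R) (u z : T -> R) (c : R) :
  u \in Lfun P 2%:E -> z \in Lfun P 2%:E ->
  (fun t => (c * u t - z t) ^+ 2) \in Lfun P 1 /\
  'E_P[fun t => ((c * u t - z t) ^+ 2)%R]%E =
  (c ^+ 2 * fine 'E_P[fun t => (u t * u t)%R]%E
    - (2 * c) * fine 'E_P[fun t => (z t * u t)%R]%E
    + fine 'E_P[fun t => (z t * z t)%R]%E)%:E.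
Proof.
move=> u2 z2.
have uu := Lfun2_mul_Lfun1 u2 u2.
have zu := Lfun2_mul_Lfun1 z2 u2.
have zz := Lfun2_mul_Lfun1 z2 z2.
have -> : (fun t => (c * u t - z t) ^+ 2) =
    ((c ^+ 2) \o* (u \* u)) \- ((2 * c) \o* (z \* u)) \+ (z \* z).
  by apply/funext => t /=; ring.
have uuc := Lfun_scale (c ^+ 2) (lexx 1) uu.
have zuc := Lfun_scale (2 * c) (lexx 1) zu.
split; first by apply: rpredD => //; apply: rpredB.
rewrite expectationD//; last by apply: rpredB.
rewrite expectationB// !expectationZl//.
(* The three moments are finite by integrability, so [fine] loses nothing. *)
by rewrite EFinD EFinB !EFinM !fineK// expectation_fin_num.
Qed.

Lemma cov_mxE d (T : measurableType d) (R : realType) (P : probability T R)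
    (m n : nat) (a : T -> 'cV[R]_m) (b : T -> 'cV[R]_n) i j :
  cov_mx P a b i j =
  fine 'E_P[fun t => ((a t - Emx P a) i ord0 * (b t - Emx P b) j ord0)%R]%E.
Proof.
rewrite mxE; congr (fine 'E_P[_]%E); apply/funext => t.
by rewrite mxE big_ord1 [_^T _ _]mxE.
Qed.

(** Coordinate [i] of [F *m v] is [F i i] times that of [v], so no covariance between distinct
    frequencies enters the error. *)
Lemma mse_diag_filter d (T : measurableType d) (R : realType)
    (P : probability T R) (n : nat) (a b : T -> 'cV[R]_n) (F : 'M[R]_n) :
  finite_second_moments P a -> finite_second_moments P b -> is_diag_mx F ->
  'E_P[fun t => (enorm (F *m (b t - Emx P b) - (a t - Emx P a)) ^+ 2)%R]%E =
  (\sum_i (F i i ^+ 2 * cov_mx P b b i i - (2 * F i i) * cov_mx P a b i i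
    + cov_mx P a a i i))%:E.
Proof.
move=> /(centered_second_moments (Emx P a)) a2.
move=> /(centered_second_moments (Emx P b)) b2 dF.
have H i := expectation_residual_sqr (F i i) (b2 i) (a2 i).
set G := fun i t => (F i i * (b t - Emx P b) i ord0 - (a t - Emx P a) i ord0) ^+ 2.
(* [expectation_sum] handles sums over a list of functions, hence the passage from indices to the
   list of the [G i]. *)
have -> : (fun t => enorm (F *m (b t - Emx P b) - (a t - Emx P a)) ^+ 2) =
    \sum_(g <- [seq G i | i <- enum 'I_n]) g.
  apply/funext => t; rewrite enorm_sqr big_map fct_sumE big_enum/=.
  by apply: eq_bigr => i _; rewrite /G -is_diag_mx_mulE// !mxE.
rewrite expectation_sum => [|_ /mapP[i _ ->]]; last exact: (H i).1.
rewrite big_map big_enum/= -sumEFin; apply: eq_bigr => i _.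
by rewrite (H i).2 !cov_mxE.
Qed.

Lemma cov_mx_diag_ge0 d (T : measurableType d) (R : realType)
    (P : probability T R) (n : nat) (a : T -> 'cV[R]_n) i :
  0 <= cov_mx P a a i i.
Proof.
rewrite cov_mxE fine_ge0// expectation_ge0// => t.
by rewrite -expr2 sqr_ge0.
Qed.

Lemma weighted_lsE (R : realType) (n : nat) (F C : 'M[R]_n) (D : 'cV[R]_n) :
  (forall i, 0 < D i ord0) ->
  enorm (diag_sqrt (diagm D) *m
    (diagv F - diagv (diagm (diagv C) *m invmx (diagm D)))) ^+ 2 =
  \sum_i D i ord0 * (F i i - C i i / D i ord0) ^+ 2.
Proof.
move=> D0; rewrite enorm_sqr; apply: eq_bigr => i _.
rewrite is_diag_mx_mulE; last first.
  (* The entrywise square root keeps the matrix diagonal because [Num.sqrt 0 = 0]. *)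
  apply/is_diag_mxP => j k jk; rewrite mxE.
  by have /is_diag_mxP -> := diagm_is_diag D; rewrite ?sqrtr0.
rewrite invmx_diagm => [|j]; last by rewrite gt_eqF.
by rewrite mulmx_diag exprMn !mxE eqxx !mulr1n sqr_sqrtr// ltW.
Qed.

(** A finite shift preserves order, and so does the embedding of the reals into the extended reals,
    where expectations live. Agreement on [Omega] suffices, which matters since [h] is known to be
    diagonal only there. *)
Lemma argmin_addr (R : realType) (A : Type) (Omega : set A) (f : A -> \bar R)
    (g : A -> R) (c : R) :
  (forall a, Omega a -> f a = (g a + c)%:E) -> argmin Omega f = argmin Omega g.
Proof.
move=> fg; apply/seteqP; split=> a [Oa le_a]; split=> // b Ob; have := le_a b Ob.
  by rewrite !fg// lee_fin lerD2r.
by rewrite !fg// lee_fin lerD2r.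
Qed.

Theorem theorem4 (R : realType) (N : nat)
    (W V : 'M[R]_N) (lam : 'cV[R]_N)
    (hW : connected_weighted_graph W)
    (hL : laplacian_evd (laplacian W) V lam)
    (d : measure_display) (T : measurableType d) (P : probability T R)
    (g : borel 'M[R]_N * borel 'cV[R]_N -> borel 'cV[R]_N)
    (hg : measurable_fun setT g)
    (x w : {RV P >-> borel 'cV[R]_N}) (y : T -> 'cV[R]_N)
    (hxw : independent_RVs P x w)
    (hx2 : finite_second_moments P x)
    (hw2 : finite_second_moments P w)
    (hy2 : finite_second_moments P y)
    (hw0 : Emx P w = 0)
    (hy : forall t, y t = g (laplacian W, x t) + (w t : 'cV[R]_N))
    (A : Type) (Omega : set A) (h : 'M[R]_N -> A -> 'M[R]_N)
    (hdiag : forall a, Omega a -> is_diag_mx (h (diagm lam) a)) :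
  let Lambda := diagm lam in
  let xt := gft V x in
  let yt := gft V y in
  let d_xy := diagv (cov_mx P xt yt) in
  let D_yy := diagm (diagv (cov_mx P yt yt)) in
  let fhat := diagm d_xy *m invmx D_yy in
  D_yy \in unitmx ->
  argmin Omega (fun a => 'E_P[fun t =>
      (enorm (h Lambda a *m (yt t - Emx P yt) - (xt t - Emx P xt)) ^+ 2)%R]%E)
  = argmin Omega (fun a =>
      enorm (diag_sqrt D_yy *m (diagv (h Lambda a) - diagv fhat)) ^+ 2).
Proof.
move=> Lambda xt yt d_xy D_yy fhat uD.
have xt2 : finite_second_moments P xt by exact: finite_second_moments_mulmx.
have yt2 : finite_second_moments P yt by exact: finite_second_moments_mulmx.
(* Variances are nonnegative, and invertibility of [D_yy] excludes zero. *)
have D_gt0 i : 0 < diagv (cov_mx P yt yt) i ord0.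
  rewrite lt_neqAle eq_sym diagm_unit_neq0//=.
  by rewrite mxE cov_mx_diag_ge0.
(* The constant is what completing the square leaves over at each frequency; it is the mean squared
   error of [fhat] itself. *)
apply: (argmin_addr (c := \sum_i (cov_mx P xt xt i i
    - cov_mx P xt yt i i ^+ 2 / cov_mx P yt yt i i))) => a Oa.
rewrite (mse_diag_filter xt2 yt2)//; last exact: hdiag.
rewrite weighted_lsE// -big_split/=; congr EFin; apply: eq_bigr => i _.
(* The completed square divides by this variance, so [field] needs it to be nonzero. *)
have := D_gt0 i; rewrite mxE => /lt0r_neq0 Di0.
by field.
Qed.
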